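(* The Killing-max property holds for the root system $F_4$: for all $\lambda,Y\in\overline{\mathfrak a^+}$ and all $w\in W$, $$\langle\lambda,w\cdot Y\rangle=\langle\lambda,Y\rangle\iff w\in W_\lambda\,W_Y .$$
   Context: For the root system $F_4$: $\mathfrak a=\mathbb R^4$ with standard basis $\mathbf e_1,\dots,\mathbf e_4$ and (up to a positive factor) the standard scalar product $\langle\cdot,\cdot\rangle$; the simple roots are $\alpha_1=\mathbf e_2-\mathbf e_3$, $\alpha_2=\mathbf e_3-\mathbf e_4$, $\alpha_3=\mathbf e_4$, $\alpha_4=(\mathbf e_1-\mathbf e_2-\mathbf e_3-\mathbf e_4)/2$; $W$ is the group generated by the orthogonal reflections $s_{\alpha_1},\dots,s_{\alpha_4}$; and $\overline{\mathfrak a^+}=\{x\in\mathbb R^4:x_1\ge x_2+x_3+x_4,\ x_2\ge x_3\ge x_4\ge0\}$ is the closed positive Weyl chamber. For $X\in\mathfrak a$, $W_X=\{w\in W:w\cdot X=X\}$; $W_\lambda W_Y=\{uv:u\in W_\lambda,v\in W_Y\}$. *)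

(* Defs.v *)
From HB Require Import structures.
From mathcomp Require Import all_boot all_order all_algebra.
From mathcomp Require Import classical_sets reals.

Set Implicit Arguments.
Unset Strict Implicit.
Unset Printing Implicit Defensive.

Import Order.TTheory GRing.Theory Num.Theory.

Local Open Scope classical_set_scope.
Local Open Scope ring_scope.

(* Vectors are columns 'cV[R]_4 and elements of the Weyl group are matrices
   'M[R]_4 acting by w *m x. Indices start at 0: the coordinate x_i is
   x (i-1) 0, where the index i-1 is a numeral of the ring 'I_4. *)

Section F4.
Variable R : realType.
Implicit Types (a x y : 'cV[R]_4) (u v w : 'M[R]_4).

Definition dotv x y : R := \sum_(i < 4) x i 0 * y i 0.

(* The invariant scalar product is only fixed up to a factor c > 0. *)
Definition scalprod (c : R) x y : R := c * dotv x y.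

(* Orthogonality, hence the reflection, does not depend on the factor c. *)
Definition reflmx a : 'M[R]_4 := 1%:M - (2 / dotv a a) *: (a *m a^T).

Lemma mul_reflmx a x : reflmx a *m x = x - (2 * dotv a x / dotv a a) *: a.
Proof.
have adot : a^T *m x = (dotv a x)%:M.
  apply/matrixP => i j; rewrite !ord1 !mxE eqxx mulr1n.
  by apply: eq_bigr => k _; rewrite mxE.
by rewrite mulmxBl mul1mx -scalemxAl -mulmxA adot mul_mx_scalar scalerA mulrAC.
Qed.

Definition ebasis (i : 'I_4) : 'cV[R]_4 := delta_mx i 0.

Definition alpha1 : 'cV[R]_4 := ebasis 1 - ebasis 2.
Definition alpha2 : 'cV[R]_4 := ebasis 2 - ebasis 3.
Definition alpha3 : 'cV[R]_4 := ebasis 3.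
Definition alpha4 : 'cV[R]_4 := 2^-1 *: (ebasis 0 - ebasis 1 - ebasis 2 - ebasis 3).

Definition simple_roots : seq 'cV[R]_4 := [:: alpha1; alpha2; alpha3; alpha4].

Inductive weylF4 : set 'M[R]_4 :=
| weylF4_refl a : a \in simple_roots -> weylF4 (reflmx a)
| weylF4_1 : weylF4 1%:M
| weylF4_mul u v : weylF4 u -> weylF4 v -> weylF4 (u *m v)
| weylF4_inv u : weylF4 u -> weylF4 (invmx u).

Definition closed_chamber : set 'cV[R]_4 :=
  [set x | x 1 0 + x 2 0 + x 3 0 <= x 0 0 /\ 0 <= x 3 0 <= x 2 0 /\
           x 2 0 <= x 1 0].

Definition stab x : set 'M[R]_4 := [set w | weylF4 w /\ w *m x = x].

Definition setmulmx (A B : set 'M[R]_4) : set 'M[R]_4 :=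
  [set u *m v | u in A & v in B].

End F4.

(* Main.v *)
Require Import Defs.
From HB Require Import structures.
From mathcomp Require Import all_boot all_order all_algebra.
From mathcomp Require Import classical_sets reals.
From mathcomp Require Import ring lra.

Set Implicit Arguments.
Unset Strict Implicit.
Unset Printing Implicit Defensive.

Import Order.TTheory GRing.Theory Num.Theory.

Local Open Scope classical_set_scope.
Local Open Scope ring_scope.

(* For w in W let n(w) be the number of positive roots that w makes negative.
   The theorem follows by induction on n(w), together with the inequality
   <lambda, wY> <= <lambda, Y>. If w keeps all simple roots positive, then
   w = 1. Otherwise w a < 0 for a simple root a, and w' = w s_a satisfies
   n(w') = n(w) - 1 and
     <lambda, w'Y> = <lambda, wY> - (2 <a, Y> / <a, a>) <lambda, w a>,
   which is at least <lambda, wY>. In the equality case either <a, Y> = 0 and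
   w = w' s_a with s_a in W_Y, or <lambda, w a> = 0 and w = t w', where
   t = w s_a w^-1 is the reflection in w a, an element of W_lambda. *)

(** * Finite computations in the root lattice *)

(* Coefficients with respect to the simple roots. *)
Definition lattice : eqType := (int * int * int * int)%type.

Definition unit1 : lattice := (1, 0, 0, 0).
Definition unit2 : lattice := (0, 1, 0, 0).
Definition unit3 : lattice := (0, 0, 1, 0).
Definition unit4 : lattice := (0, 0, 0, 1).

(* Twice the scalar product, which makes it integral. *)
Definition gram (u v : lattice) : int :=
  let: (a, b, c, d) := u in let: (a', b', c', d') := v in
  4 * (a * a' + b * b') + 2 * (c * c' + d * d')
  - 2 * (a * b' + b * a') - 2 * (b * c' + c * b') - (c * d' + d * c').

(* The roots of F4 are the vectors of square norm 1 or 2 in the root lattice;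
   the box is bounded by the highest root, (2, 3, 4, 2). *)
Definition posroots : seq lattice :=
  [seq v <- [seq (u, Posz d) | u <- [seq (u, Posz c) | u <-
    [seq (Posz a, Posz b) | a <- iota 0 3, b <- iota 0 4], c <- iota 0 5],
    d <- iota 0 3] | gram v v \in [:: 2; 4]].

(** The simple reflections in coordinates; each changes only its own coefficient. The factor 2 in
    [lrefl3] comes from the double bond: [2 <alpha2, alpha3> / <alpha3, alpha3> = -2]. *)
Definition lrefl1 (v : lattice) : lattice :=
  let: (a, b, c, d) := v in (b - a, b, c, d).
Definition lrefl2 (v : lattice) : lattice :=
  let: (a, b, c, d) := v in (a, a - b + c, c, d).
Definition lrefl3 (v : lattice) : lattice :=
  let: (a, b, c, d) := v in (a, b, 2 * b - c + d, d).
Definition lrefl4 (v : lattice) : lattice :=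
  let: (a, b, c, d) := v in (a, b, c, c - d).

Lemma posroots_ge0 :
  all (fun v => let: (a, b, c, d) := v in
    [&& 0 <= a, 0 <= b, 0 <= c & 0 <= d]) posroots.
Proof. by vm_compute. Qed.

(** Comparing lists up to permutation is decidable by computation and preserves the counts behind
    [inversions]. *)
Definition permutes_others (e : lattice) (f : lattice -> lattice) :=
  (e \in posroots) && perm_eq (map f (rem e posroots)) (rem e posroots).

Lemma permutes_others_lrefl :
  [/\ permutes_others unit1 lrefl1, permutes_others unit2 lrefl2,
      permutes_others unit3 lrefl3 & permutes_others unit4 lrefl4].
Proof. by vm_compute. Qed.

(* The simple roots are the only positive roots with their Gram matrix. The
   nested filters prune the search, which would otherwise visit 24^4 cases. *)
Lemma gram_posroots_rigid :
  all (fun a => all (fun b => all (fun c => all (fun d =>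
      (a, b, c, d) == (unit1, unit2, unit3, unit4))
    [seq d <- posroots |
      [&& gram d d == 2, gram a d == 0, gram b d == 0 & gram c d == -1]])
    [seq c <- posroots | [&& gram c c == 2, gram a c == 0 & gram b c == -2]])
    [seq b <- posroots | (gram b b == 4) && (gram a b == -2)])
    [seq a <- posroots | gram a a == 4].
Proof. by vm_compute. Qed.

Section F4Roots.
Variable R : realType.
Implicit Types (a x y z : 'cV[R]_4) (u v w : 'M[R]_4) (l : lattice).

(** * Scalar product and reflections *)

Lemma ord4P (i : 'I_4) : [|| i == 0, i == 1, i == 2 | i == 3].
Proof. by case: i => -[|[|[|[|]]]]. Qed.

Lemma sum4 (F : 'I_4 -> R) : \sum_(i < 4) F i = F 0 + F 1 + F 2 + F 3.
Proof.
rewrite !big_ord_recl big_ord0 addr0 !addrA.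
by do !congr (_ + _); congr F; apply: val_inj.
Qed.

Lemma dotvE x y : dotv x y = (x^T *m y) 0 0.
Proof. by rewrite mxE; apply: eq_bigr => i _; rewrite mxE. Qed.

Lemma dotvC x y : dotv x y = dotv y x.
Proof. by apply: eq_bigr => i _; rewrite mulrC. Qed.

Lemma dotvDr x y z : dotv x (y + z) = dotv x y + dotv x z.
Proof. by rewrite !dotvE mulmxDr mxE. Qed.

Lemma dotvZr k x y : dotv x (k *: y) = k * dotv x y.
Proof. by rewrite !dotvE -scalemxAr mxE. Qed.

Lemma dotv_adj w x y : dotv (w *m x) y = dotv x (w^T *m y).
Proof. by rewrite !dotvE trmx_mul mulmxA. Qed.

Lemma mulmx_cV_inj u v : (forall x, u *m x = v *m x) -> u = v.
Proof.
move=> uv; apply/matrixP => i j.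
have /colP/(_ i) := uv (delta_mx j 0).
by rewrite -!colE !mxE.
Qed.

Lemma tr_reflmx a : (reflmx a)^T = reflmx a.
Proof.
by rewrite /reflmx linearB linearZ /= trmx1 trmx_mul trmxK.
Qed.

Lemma reflmx_self a : dotv a a != 0 -> reflmx a *m a = - a.
Proof.
by move=> a0; rewrite mul_reflmx mulfK // scaler_nat mulr2n opprD addNKr.
Qed.

Lemma reflmxK a : dotv a a != 0 -> reflmx a *m reflmx a = 1%:M.
Proof.
move=> a0; apply: mulmx_cV_inj => x.
rewrite -mulmxA [X in _ *m X]mul_reflmx mulmxBr -scalemxAr reflmx_self //.
by rewrite mul_reflmx scalerN opprK subrK mul1mx.
Qed.

Lemma simple_rootsP a : a \in simple_roots R ->
  [\/ a = alpha1 R, a = alpha2 R, a = alpha3 R | a = alpha4 R].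
Proof.
by rewrite !inE => /or4P[] /eqP->; constructor.
Qed.

(** * From lattice coordinates to vectors *)

Definition emb l : 'cV[R]_4 :=
  let: (a, b, c, d) := l in
  a%:~R *: alpha1 R + b%:~R *: alpha2 R + c%:~R *: alpha3 R + d%:~R *: alpha4 R.

Lemma emb_unit : [/\ emb unit1 = alpha1 R, emb unit2 = alpha2 R,
  emb unit3 = alpha3 R & emb unit4 = alpha4 R].
Proof. by split; rewrite /emb /= !scale0r !scale1r ?addr0 ?add0r. Qed.

(** A nested product of equations, so that a single [rewrite] can use them all. *)
Lemma dotv_alpha :
  ((dotv (alpha1 R) (alpha1 R) = 2) * (dotv (alpha2 R) (alpha2 R) = 2) *
  (dotv (alpha3 R) (alpha3 R) = 1) * (dotv (alpha4 R) (alpha4 R) = 1)) *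
  ((dotv (alpha1 R) (alpha2 R) = -1) * (dotv (alpha1 R) (alpha3 R) = 0) *
  (dotv (alpha1 R) (alpha4 R) = 0) * (dotv (alpha2 R) (alpha3 R) = -1) *
  (dotv (alpha2 R) (alpha4 R) = 0) * (dotv (alpha3 R) (alpha4 R) = - 2^-1)).
Proof. by do !split; rewrite /dotv sum4 !mxE /=; field. Qed.

Definition dotv_alphaC := (dotv_alpha, (dotvC (alpha2 R) (alpha1 R),
  dotvC (alpha3 R) (alpha1 R), dotvC (alpha4 R) (alpha1 R),
  dotvC (alpha3 R) (alpha2 R), dotvC (alpha4 R) (alpha2 R),
  dotvC (alpha4 R) (alpha3 R))).

Lemma dotv_embr x l : dotv x (emb l) = let: (a, b, c, d) := l in
  a%:~R * dotv x (alpha1 R) + b%:~R * dotv x (alpha2 R) +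
  c%:~R * dotv x (alpha3 R) + d%:~R * dotv x (alpha4 R).
Proof. by case: l => [[[a b] c] d]; rewrite /emb /= 3!dotvDr 4!dotvZr. Qed.

Lemma gramE l l' : dotv (emb l) (emb l') = (gram l l')%:~R / 2.
Proof.
case: l l' => [[[a b] c] d] [[[a' b'] c'] d'].
rewrite dotv_embr !(dotvC (emb _)) !dotv_embr !dotv_alphaC /gram.
by rewrite !(intrD, intrM, intrB, rmorphN) /=; field.
Qed.

Lemma dotv_simple_neq0 a : a \in simple_roots R -> dotv a a != 0.
Proof.
by case/simple_rootsP => ->; rewrite !dotv_alpha ?oner_eq0 ?pnatr_eq0.
Qed.

Lemma dotv_simple_ge0 a x : closed_chamber x -> a \in simple_roots R ->
  0 <= dotv x a.
Proof.
case=> x0 [/andP[x3 x2] x1].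
by case/simple_rootsP => ->; rewrite /dotv sum4 !mxE /=; lra.
Qed.

Lemma reflmx_emb l :
  [/\ reflmx (alpha1 R) *m emb l = emb (lrefl1 l),
      reflmx (alpha2 R) *m emb l = emb (lrefl2 l),
      reflmx (alpha3 R) *m emb l = emb (lrefl3 l) &
      reflmx (alpha4 R) *m emb l = emb (lrefl4 l)].
Proof.
by split; rewrite mul_reflmx dotv_embr; case: l => [[[a b] c] d];
  rewrite !dotv_alphaC /emb /=;
  (* With the scalar products evaluated, the identity holds for any four vectors; generalizing keeps
     [mxE] from expanding the roots. *)
  move: (alpha1 R) (alpha2 R) (alpha3 R) (alpha4 R) => x1 x2 x3 x4;
  apply/colP => i; rewrite !mxE !(intrD, intrM, mulrNz) /=; field.
Qed.

(** Packs the four cases, so that later arguments treat all simple roots alike. *)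
Lemma simple_root_lattice a : a \in simple_roots R ->
  exists e f, [/\ a = emb e, permutes_others e f &
                  forall l, reflmx a *m emb l = emb (f l)].
Proof.
have [p1 p2 p3 p4] := permutes_others_lrefl.
have [E1 E2 E3 E4] := emb_unit.
case/simple_rootsP => ->.
- by exists unit1, lrefl1;
  split; [rewrite E1 | exact: p1 | move=> l; have [] := reflmx_emb l].
- by exists unit2, lrefl2;
  split; [rewrite E2 | exact: p2 | move=> l; have [] := reflmx_emb l].
- by exists unit3, lrefl3;
  split; [rewrite E3 | exact: p3 | move=> l; have [] := reflmx_emb l].
- by exists unit4, lrefl4;
  split; [rewrite E4 | exact: p4 | move=> l; have [] := reflmx_emb l].
Qed.

Definition posroot_vectors : seq 'cV[R]_4 := map emb posroots.

(** Positive roots are nonnegative combinations of simple roots. *)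
Lemma posroot_dotv_ge0 x y : closed_chamber x -> y \in posroot_vectors ->
  0 <= dotv x y.
Proof.
move=> xC /mapP[l lP ->].
have := allP posroots_ge0 _ lP.
case: l {lP} => [[[a b] c] d] /and4P[a0 b0 c0 d0].
have pos k a' : 0 <= k -> a' \in simple_roots R -> 0 <= k%:~R * dotv x a'.
  by move=> k0 aS; rewrite mulr_ge0 ?ler0z ?dotv_simple_ge0.
by rewrite dotv_embr !addr_ge0 // pos // !inE eqxx ?orbT.
Qed.

Lemma posroot_reflmx a : a \in simple_roots R ->
  exists s, perm_eq posroot_vectors (a :: s) /\
            perm_eq (map (mulmx (reflmx a)) s) s.
Proof.
case/simple_root_lattice => e [f [-> /andP[eP fP] sE]].
(* Removing the root before embedding lets the computed permutation carry over by [perm_map]. *)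
exists (map emb (rem e posroots)); split.
  by rewrite -map_cons; apply/perm_map/perm_to_rem.
have -> : map (mulmx (reflmx (emb e))) (map emb (rem e posroots)) =
    map emb (map f (rem e posroots)).
  by rewrite -!map_comp; apply: eq_map => l; apply: sE.
exact: perm_map.
Qed.

Lemma simple_posroot a : a \in simple_roots R -> a \in posroot_vectors.
Proof.
by case/posroot_reflmx => s [/perm_mem-> _]; rewrite mem_head.
Qed.

(** * The action of the Weyl group on the roots *)

Definition is_root x := (x \in posroot_vectors) || (- x \in posroot_vectors).

Lemma is_root_reflmx a x : a \in simple_roots R -> is_root x ->
  is_root (reflmx a *m x).
Proof.
move=> aS; have [s [aP sP]] := posroot_reflmx aS.
have pos y : y \in posroot_vectors -> is_root (reflmx a *m y).
  rewrite (perm_mem aP) inE => /predU1P[->|ys].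
    rewrite /is_root reflmx_self ?dotv_simple_neq0 // opprK.
    by rewrite (simple_posroot aS) orbT.
  by rewrite /is_root !(perm_mem aP) inE -(perm_mem sP) map_f ?orbT.
case/orP=> [/pos//|/pos].
by rewrite mulmxN /is_root opprK orbC.
Qed.

Lemma weylF4_orthogonal w : weylF4 w -> w^T *m w = 1%:M.
Proof.
elim=> [a aS||u v _ uO _ vO|u _ uO].
- by rewrite tr_reflmx reflmxK ?dotv_simple_neq0.
- by rewrite trmx1 mulmx1.
- by rewrite trmx_mul mulmxA -(mulmxA v^T) uO mulmx1.
- have uU : u \in unitmx by have [] := mulmx1_unit uO.
  by rewrite -[invmx u]mul1mx -uO mulmxK // trmxK mulmx1C.
Qed.

Lemma weylF4_tr w : weylF4 w -> weylF4 w^T.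
Proof.
move=> wW; have wO := weylF4_orthogonal wW.
have wU : w \in unitmx by have [] := mulmx1_unit wO.
by rewrite -[w^T](mulmxK wU) wO mul1mx; apply: weylF4_inv.
Qed.

Lemma weylF4_mulmxT w : weylF4 w -> w *m w^T = 1%:M.
Proof. by move=> wW; apply/mulmx1C/weylF4_orthogonal. Qed.

Lemma is_root_weylF4 w x : weylF4 w -> is_root x -> is_root (w *m x).
Proof.
(* The transpose is carried along because it is the inverse of [w], which settles the [invmx] case
   of the induction. *)
move=> wW; suff: forall x, is_root x -> is_root (w *m x) /\ is_root (w^T *m x).
  by move=> h /h[].
elim: wW {x} => [a aS||u v _ uR _ vR|u uW uR] x xR.
- by rewrite tr_reflmx is_root_reflmx.
- by rewrite trmx1 mul1mx.
- rewrite trmx_mul -!mulmxA; split.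
    by apply: (uR _ _).1; apply: (vR _ _).1.
  by apply: (vR _ _).2; apply: (uR _ _).2.
- have uO := weylF4_orthogonal uW.
  have uU : u \in unitmx by have [] := mulmx1_unit uO.
  have -> : invmx u = u^T by rewrite -[invmx u]mul1mx -uO mulmxK.
  by rewrite trmxK; case: (uR _ xR).
Qed.

Lemma weylF4_simple_neg w a : weylF4 w -> a \in simple_roots R ->
  w *m a \notin posroot_vectors -> - (w *m a) \in posroot_vectors.
Proof.
move=> wW aS waN; have: is_root a by rewrite /is_root simple_posroot.
by move/(is_root_weylF4 wW); rewrite /is_root (negPf waN).
Qed.

Lemma weylF4_dotv w x y : weylF4 w -> dotv (w *m x) (w *m y) = dotv x y.
Proof. by move=> wW; rewrite dotv_adj mulmxA weylF4_orthogonal ?mul1mx. Qed.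

(** By orthogonality the images of the simple roots are positive roots with the same Gram matrix, so
    [gram_posroots_rigid] shows that [w] fixes every simple root; these span the space. *)
Lemma weylF4_pos_eq1 w : weylF4 w ->
  (forall a, a \in simple_roots R -> w *m a \in posroot_vectors) -> w = 1%:M.
Proof.
move=> wW wP.
have [E1 E2 E3 E4] := emb_unit.
have image a : a \in simple_roots R ->
    exists2 l, l \in posroots & w *m a = emb l.
  by move/wP/mapP.
have gramP x y l l' n : w *m x = emb l -> w *m y = emb l' ->
    2 * dotv x y = n%:~R -> gram l l' == n.
  move=> xl yl xy; apply/eqP/(@intr_inj R).
  by rewrite -xy -(weylF4_dotv x y wW) xl yl gramE mulrC divfK ?pnatr_eq0.
have allE (P Q : pred lattice) s l :
    all P [seq x <- s | Q x] -> l \in s -> Q l -> P l.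
  by move=> /allP h ls Ql; apply: h; rewrite mem_filter Ql.
have [|a aP wa] := image (alpha1 R); first by rewrite !inE eqxx.
have [|b bP wb] := image (alpha2 R); first by rewrite !inE eqxx ?orbT.
have [|c cP wc] := image (alpha3 R); first by rewrite !inE eqxx ?orbT.
have [|d dP wd] := image (alpha4 R); first by rewrite !inE eqxx ?orbT.
have/eqP[ea eb ec ed] : (a, b, c, d) == (unit1, unit2, unit3, unit4).
  (* The nested filters are peeled off one root at a time; each filter condition is a Gram entry
     preserved by [w]. *)
  have := allE _ _ _ _ gram_posroots_rigid aP.
  rewrite (gramP _ _ _ _ 4 wa wa); last by rewrite dotv_alpha -natrM.
  move=> /(_ isT) /allE /(_ bP).
  rewrite (gramP _ _ _ _ 4 wb wb); last by rewrite dotv_alpha -natrM.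
  rewrite (gramP _ _ _ _ (-2) wa wb); last by rewrite dotv_alpha mulrN1.
  move=> /(_ isT) /allE /(_ cP).
  rewrite (gramP _ _ _ _ 2 wc wc); last by rewrite dotv_alpha mulr1.
  rewrite (gramP _ _ _ _ 0 wa wc); last by rewrite dotv_alpha mulr0.
  rewrite (gramP _ _ _ _ (-2) wb wc); last by rewrite dotv_alpha mulrN1.
  move=> /(_ isT) /allE /(_ dP).
  rewrite (gramP _ _ _ _ 2 wd wd); last by rewrite dotv_alpha mulr1.
  rewrite (gramP _ _ _ _ 0 wa wd); last by rewrite dotv_alpha mulr0.
  rewrite (gramP _ _ _ _ 0 wb wd); last by rewrite dotv_alpha mulr0.
  rewrite (gramP _ _ _ _ (-1) wc wd);
    last by rewrite dotv_alpha mulrN divff ?pnatr_eq0.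
  by move=> /(_ isT).
move: wa wb wc wd; rewrite {}ea {}eb {}ec {}ed E1 E2 E3 E4 => wa wb wc wd.
apply: mulmx_cV_inj => x.
(* The brackets express the standard basis vectors in the simple roots. *)
have -> : x =
  x 0 0 *: (2 *: alpha4 R + alpha1 R + 2 *: alpha2 R + 3 *: alpha3 R)
  + x 1 0 *: (alpha1 R + alpha2 R + alpha3 R) + x 2 0 *: (alpha2 R + alpha3 R)
  + x 3 0 *: alpha3 R.
  by apply/colP => i; have /or4P[] := ord4P i => /eqP->; rewrite !mxE /=; field.
move: (alpha1 R) (alpha2 R) (alpha3 R) (alpha4 R) wa wb wc wd.
move=> x1 x2 x3 x4 wa wb wc wd.
by rewrite mul1mx !(mulmxDr, =^~ scalemxAr) wa wb wc wd.
Qed.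

(** * Induction on the number of inversions *)

Definition inversions w :=
  count (fun x => w *m x \notin posroot_vectors) posroot_vectors.

(** The reflection permutes the positive roots other than [a], so these contribute equally to both
    counts. The root [a] counts for [w] only, as [w *m reflmx a] sends it to the positive root
    [- (w *m a)]. *)
Lemma inversions_reflmx w a : weylF4 w -> a \in simple_roots R ->
  w *m a \notin posroot_vectors ->
  inversions w = (inversions (w *m reflmx a)).+1.
Proof.
move=> wW aS waN; have [s [aP sP]] := posroot_reflmx aS.
have Nwa := weylF4_simple_neg wW aS waN.
rewrite /inversions !(permP aP) /= waN -mulmxA reflmx_self ?dotv_simple_neq0 //.
rewrite mulmxN Nwa add0n add1n -(permP sP) count_map.
by congr _.+1; apply: eq_count => x /=; rewrite mulmxA.
Qed.

(** Both claims go through one induction: the equality case for [w] needs the inequality for the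
    shorter element [w']. *)
Lemma dotv_weylF4_max (lambda Y : 'cV[R]_4) w :
  closed_chamber lambda -> closed_chamber Y -> weylF4 w ->
  dotv lambda (w *m Y) <= dotv lambda Y /\
  (dotv lambda (w *m Y) = dotv lambda Y -> setmulmx (stab lambda) (stab Y) w).
Proof.
move=> lC YC; have [n] := ubnP (inversions w); elim: n w => // n IHn w wn wW.
have [/allP wP|/allPn[a aS waN]] :=
  boolP (all (fun a => w *m a \in posroot_vectors) (simple_roots R)).
  rewrite (weylF4_pos_eq1 wW wP) mul1mx; split=> // _.
  exists 1%:M; first by split; [apply: weylF4_1 | rewrite mul1mx].
  by exists 1%:M; rewrite ?mul1mx //; split; [apply: weylF4_1 | rewrite mul1mx].
have sW := weylF4_refl aS; have a0 := dotv_simple_neq0 aS.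
have Nwa := weylF4_simple_neg wW aS waN.
set w' := w *m reflmx a.
have w'W : weylF4 w' by apply: weylF4_mul.
have wE : w = w' *m reflmx a by rewrite -mulmxA reflmxK ?mulmx1.
have [|le' eq'] := IHn w' _ w'W; first by rewrite -ltnS -inversions_reflmx.
have la : dotv lambda (w *m a) <= 0.
  have := posroot_dotv_ge0 lC Nwa.
  by rewrite -scaleN1r dotvZr mulN1r oppr_ge0.
have Ya : 0 <= 2 * dotv a Y / dotv a a.
  have aa : 0 <= dotv a a.
    by rewrite /dotv; apply: sumr_ge0 => i _; apply: sqr_ge0.
  by rewrite divr_ge0 ?mulr_ge0 // dotvC dotv_simple_ge0.
have lw' : dotv lambda (w' *m Y) =
    dotv lambda (w *m Y) - 2 * dotv a Y / dotv a a * dotv lambda (w *m a).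
  rewrite -mulmxA mul_reflmx mulmxBr -scalemxAr -scaleN1r scalerA.
  by rewrite dotvDr dotvZr mulN1r mulNr.
have cla := mulr_ge0_le0 Ya la.
have le1 : dotv lambda (w *m Y) <= dotv lambda (w' *m Y).
  by rewrite lw' lerDl oppr_ge0.
split; first exact: le_trans le1 le'.
move=> eqY.
(* The value at [w'] is squeezed between two equal bounds. *)
have eq1 : dotv lambda (w' *m Y) = dotv lambda Y.
  by apply/eqP; rewrite eq_le le' -eqY.
have [u [uW ul] [v [vW vY] uv]] := eq' eq1.
have /eqP : 2 * dotv a Y / dotv a a * dotv lambda (w *m a) = 0.
  by move: lw'; rewrite eq1 eqY; lra.
rewrite mulf_eq0 => /orP[/eqP aY0|/eqP la0].
  exists u => //; exists (v *m reflmx a); last by rewrite mulmxA uv -wE.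
  split; first exact: weylF4_mul.
  by rewrite -mulmxA mul_reflmx aY0 scale0r subr0.
(* As [w^T] inverts [w], the product [w *m reflmx a *m w^T] is the reflection in [w *m a], and it
   takes [w'] back to [w]. *)
exists (w *m reflmx a *m w^T *m u); last first.
  exists v => //.
  by rewrite -!mulmxA uv /w' (mulmxA w^T) weylF4_orthogonal //
             mul1mx reflmxK ?mulmx1.
split; first by do !apply: weylF4_mul => //; apply: weylF4_tr.
rewrite -!mulmxA ul mul_reflmx -dotv_adj (dotvC (w *m a)) la0 mulr0 mul0r.
by rewrite scale0r subr0 mulmxA weylF4_mulmxT ?mul1mx.
Qed.

End F4Roots.

Theorem propositionA12 (R : realType) (c : R) (c_gt0 : 0 < c)
    (lambda Y : 'cV[R]_4)
    (lambda_chamber : closed_chamber lambda) (Y_chamber : closed_chamber Y)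
    (w : 'M[R]_4) (w_weyl : weylF4 w) :
  scalprod c lambda (w *m Y) = scalprod c lambda Y
  <-> setmulmx (stab lambda) (stab Y) w.
Proof.
rewrite /scalprod; split=> [/(mulfI (lt0r_neq0 c_gt0))|].
  exact: (dotv_weylF4_max lambda_chamber Y_chamber w_weyl).2.
(* Conversely, [v] is absorbed by [Y]; writing [lambda] as [u *m lambda] on the left, orthogonality
   cancels [u]. *)
case=> u [uW ul] [v [_ vY] <-].
by rewrite -mulmxA vY -[in LHS]ul weylF4_dotv.
Qed.
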